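(* There is a universal constant $C>0$ such that the following holds. Let $\mathbf{A}\in\mathbb{R}^{m\times n}$, $1\le k<\min(m,n)$, $f>1$, and let $\widehat{\mathbf{L}},\widehat{\mathbf{U}}$ be the factors of a rank-$k$ SRLU factorization of $\mathbf{A}$ produced by Spectrum-Revealing Pivoting (SRP) with tolerance $f$. Then there is a number $\tau\le C\,mnk^2f^3$ (that is, $\tau\le O(mnk^2f^3)$) such that for all $1\le j\le k$, $$\frac{\sigma_j(\mathbf{A})}{1+\tau\frac{\sigma_{k+1}(\mathbf{A})}{\sigma_j(\mathbf{A})}}\le\sigma_j(\widehat{\mathbf{L}}\widehat{\mathbf{U}})\le\sigma_j(\mathbf{A})\left(1+\tau\frac{\sigma_{k+1}(\mathbf{A})}{\sigma_j(\mathbf{A})}\right).$$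
   Context: A rank-$k$ truncated LU factorization of $\mathbf{A}\in\mathbb{R}^{m\times n}$ consists of permutation matrices $\Pi_1$ ($m\times m$) and $\Pi_2$ ($n\times n$) and an exact block factorization $$\Pi_1\mathbf{A}\Pi_2^T=\begin{pmatrix}\mathbf{L}_{11}&0\\ \mathbf{L}_{21}&\mathbf{I}_{m-k}\end{pmatrix}\begin{pmatrix}\mathbf{U}_{11}&\mathbf{U}_{12}\\0&\mathbf{S}\end{pmatrix},$$ where $\mathbf{L}_{11}\in\mathbb{R}^{k\times k}$ is lower triangular with unit diagonal, $\mathbf{L}_{21}\in\mathbb{R}^{(m-k)\times k}$, $\mathbf{U}_{11}\in\mathbb{R}^{k\times k}$ is upper triangular and nonsingular, $\mathbf{U}_{12}\in\mathbb{R}^{k\times(n-k)}$, and $\mathbf{S}\in\mathbb{R}^{(m-k)\times(n-k)}$ is the Schur complement. Set $\widehat{\mathbf{L}}=\begin{pmatrix}\mathbf{L}_{11}\\ \mathbf{L}_{21}\end{pmatrix}$ and $\widehat{\mathbf{U}}=\begin{pmatrix}\mathbf{U}_{11}&\mathbf{U}_{12}\end{pmatrix}$. Spectrum-Revealing Pivoting (SRP) with tolerance parameter $f>1$. Let $\alpha=\mathbf{S}_{pq}$ be an entry of $\mathbf{S}$ of largest absolute value (assumed nonzero), let $\ell^T$ be the $p$-th row of $\mathbf{L}_{21}$ and $u$ the $q$-th column of $\mathbf{U}_{12}$, and put $$\overline{\mathbf{A}}_{11}=\begin{pmatrix}\mathbf{L}_{11}&0\\ \ell^T&1\end{pmatrix}\begin{pmatrix}\mathbf{U}_{11}&u\\0&\alpha\end{pmatrix}\in\mathbb{R}^{(k+1)\times(k+1)}.$$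 While $\|\overline{\mathbf{A}}_{11}^{-1}\|_{\max}>f/|\alpha|$, SRP swaps the row and column containing $\alpha$ with the row and column corresponding to the largest-magnitude entry of $\overline{\mathbf{A}}_{11}^{-1}$, and updates the truncated LU factorization and $\alpha$. A rank-$k$ SRLU factorization produced by SRP is the truncated LU factorization at termination, i.e. one satisfying $$\|\overline{\mathbf{A}}_{11}^{-1}\|_{\max}\le\frac{f}{|\alpha|}.$$ Here $\|\cdot\|_{\max}$ is the largest absolute value of an entry and $\sigma_1(\cdot)\ge\sigma_2(\cdot)\ge\cdots$ are the singular values. *)

(* Defs.v *)
From HB Require Import structures.
From mathcomp Require Import all_boot all_order all_algebra all_fingroup.
From mathcomp Require Import reals normedtype.
From mathcomp Require Import polyrcf.
Set Implicit Arguments.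
Unset Strict Implicit.
Unset Printing Implicit Defensive.
Import Order.TTheory GRing.Theory Num.Theory.
Local Open Scope ring_scope.

(* The real eigenvalues of [M] in nonincreasing order, each repeated according
   to its algebraic multiplicity, i.e. its multiplicity as a root of
   [char_poly M]; [rootsR] lists the distinct real roots. *)
Definition eigenvalues (R : rcfType) (n : nat) (M : 'M[R]_n) : seq R :=
  sort >=%R (flatten [seq nseq (mup x (char_poly M)) x
                     | x <- rootsR (char_poly M)]).

Lemma eigenvaluesE (R : rcfType) (n : nat) (M : 'M[R]_n) (s : seq R) :
  char_poly M = \prod_(x <- s) ('X - x%:P) -> sorted >=%R s ->
  eigenvalues M = s.
Proof.
move=> charM s_sorted.
have p0 : char_poly M != 0 by apply: monic_neq0; exact: char_poly_monic.
have ge_tr : transitive (>=%R : rel R) by move=> y x z xy /le_trans; apply.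
have ge_anti : antisymmetric (>=%R : rel R).
  by move=> x y; rewrite andbC => /le_anti.
rewrite /eigenvalues; apply: (sorted_eq ge_tr ge_anti) => //.
  by apply: sort_sorted => x y; exact: le_total.
rewrite perm_sort; apply/allP => x _ /=; apply/eqP.
rewrite -[RHS]mu_prod_XsubC -charM.
rewrite count_flatten -map_comp sumnE big_map.
under eq_bigr => y _ do rewrite /= count_nseq /=.
have uR : uniq (rootsR (char_poly M)) by exact: uniq_roots.
have [xr|xr] := boolP (x \in rootsR (char_poly M)).
  rewrite (bigD1_seq x) //= eqxx mul1n big1 ?addn0 // => y /negbTE.
  by move=> ->.
rewrite big1_seq => [|y /andP[_ yr]]; last first.
  by case: eqVneq => // yx; rewrite yx (negbTE xr) in yr.
rewrite mupNroot //.
have := roots_on_rootsR p0 x; rewrite in_itv /= => ->; exact: xr.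
Qed.

(* [singular_value A j] is sigma_j(A), numbered from j = 1, for
   1 <= j <= minn m n.  The [n] eigenvalues of A^T A are all real and
   nonnegative, and all but the first [minn m n] of them vanish. *)
Definition singular_value (R : rcfType) (m n : nat) (A : 'M[R]_(m, n))
    (j : nat) : R :=
  Num.sqrt (nth 0 (eigenvalues (A^T *m A)) j.-1).

Lemma subnKC_minl (k m n : nat) : (k < minn m n)%N -> (k + (m - k))%N = m.
Proof. by rewrite leq_min => /andP[/ltnW/subnKC]. Qed.

Lemma subnKC_minr (k m n : nat) : (k < minn m n)%N -> (k + (n - k))%N = n.
Proof. by rewrite leq_min => /andP[_ /ltnW/subnKC]. Qed.

(* The [castmx] only identifies k + (m - k) with m and k + (n - k) with n. *)
Definition truncated_LU (R : realType) (m n k : nat) (hk : (k < minn m n)%N)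
    (A : 'M[R]_(m, n)) (p1 : 'S_m) (p2 : 'S_n)
    (L11 : 'M[R]_k) (L21 : 'M[R]_(m - k, k))
    (U11 : 'M[R]_k) (U12 : 'M[R]_(k, n - k))
    (S : 'M[R]_(m - k, n - k)) : Prop :=
  [/\ is_trig_mx L11 /\ (forall i, L11 i i = 1),
      is_trig_mx U11^T,
      U11 \in unitmx &
      perm_mx p1 *m A *m (perm_mx p2)^T =
      castmx (subnKC_minl hk, subnKC_minr hk)
        (block_mx L11 0 L21 1%:M *m block_mx U11 U12 0 S)].

(* The matrix obtained by bordering L11 U11 with the pivot alpha = S p q. *)
Definition bordered (R : realType) (k r s : nat)
    (L11 : 'M[R]_k) (L21 : 'M[R]_(r, k))
    (U11 : 'M[R]_k) (U12 : 'M[R]_(k, s))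
    (S : 'M[R]_(r, s)) (p : 'I_r) (q : 'I_s) : 'M[R]_(k + 1) :=
  block_mx L11 0 (row p L21) 1%:M *m block_mx U11 (col q U12) 0 (S p q)%:M.

(* The stopping criterion of spectrum-revealing pivoting: [mx_norm] is the
   largest absolute value of an entry.  When L11 is unit lower triangular, U11
   is nonsingular and S p q != 0, the bordered matrix is invertible, so that
   [invmx] is its genuine inverse. *)
Definition SRP_stopped (R : realType) (k r s : nat) (f : R)
    (L11 : 'M[R]_k) (L21 : 'M[R]_(r, k))
    (U11 : 'M[R]_k) (U12 : 'M[R]_(k, s)) (S : 'M[R]_(r, s)) : Prop :=
  exists (p : 'I_r) (q : 'I_s),
    [/\ forall i j, `|S i j| <= `|S p q|,
        S p q != 0 &
        mx_norm (invmx (bordered L11 L21 U11 U12 S p q)) <= f / `|S p q|].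

Definition SRLU (R : realType) (m n k : nat) (hk : (k < minn m n)%N) (f : R)
    (A : 'M[R]_(m, n)) (p1 : 'S_m) (p2 : 'S_n)
    (L11 : 'M[R]_k) (L21 : 'M[R]_(m - k, k))
    (U11 : 'M[R]_k) (U12 : 'M[R]_(k, n - k))
    (S : 'M[R]_(m - k, n - k)) : Prop :=
  truncated_LU hk A p1 p2 L11 L21 U11 U12 S /\
  SRP_stopped f L11 L21 U11 U12 S.

(* Main.v *)
Require Import Defs.
From HB Require Import structures.
From mathcomp Require Import all_boot all_order all_algebra all_fingroup.
From mathcomp Require Import reals normedtype.
From mathcomp Require Import spectral complex ring lra.
Set Implicit Arguments.
Unset Strict Implicit.
Unset Printing Implicit Defensive.
Import Order.TTheory GRing.Theory Num.Theory.
Local Open Scope ring_scope.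

(** Let M be the permuted matrix, B the product of the truncated factors and
    alpha the pivot.  Then M - B is the Schur complement S padded with zeros,
    whose entries are at most |alpha|, so its operator norm is at most w |alpha|
    with w = sqrt (m n), and Weyl's inequality ([singular_valueD]) puts
    sigma_j(M) and sigma_j(B) within w |alpha| of each other.  The stopping
    criterion compares |alpha| with two singular values.

    The bordered matrix is a submatrix of M, and its inverse has entries of size
    at most f / |alpha|, hence norm at most (k + 1) f / |alpha|.  As passing to a
    submatrix cannot increase singular values
    ([singular_value_ge_compression]), |alpha| <= (k + 1) f sigma_(k+1)(M)
    ([pivot_le_next_singular_value]).

    The inverse of the pivot block L11 U11 is a Schur complement in the inverse
    of the bordered matrix ([inv_pivot_block]), so its entries are at most
    f / |alpha| + f ^ 2 / |alpha| <= 2 f ^ 2 / |alpha|.  The pivot block is a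
    submatrix of B, whence |alpha| <= 2 f ^ 2 k sigma_j(B) for j <= k
    ([pivot_le_truncated_singular_value]).

    The first comparison turns the additive error w |alpha| into a multiple of
    sigma_(k+1)(M), which is the upper bound.  The second bounds the ratio
    sigma_j(M) / sigma_j(B) by 3 f ^ 2 k w, which is what it costs to express the
    same error relatively to sigma_j(B) in the lower bound; the product of the
    two factors is 6 m n k ^ 2 f ^ 3 ([perturbation_arithmetic]).

    The facts on singular values come from the orthogonal diagonalization of
    real symmetric matrices ([spectral_symmetric]) through the half of the
    Courant-Fischer theorem that bounds singular values from below
    ([singular_value_ge]). *)

(** * The Euclidean norm of column vectors *)

Section EuclideanNorm.
Variable R : rcfType.

Definition enorm (n : nat) (x : 'cV[R]_n) : R :=
  Num.sqrt (\sum_i x i 0 ^+ 2).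

Lemma enorm_ge0 n (x : 'cV_n) : 0 <= enorm x.
Proof. exact: sqrtr_ge0. Qed.

Lemma sum_sqr_ge0 n (a : 'I_n -> R) : 0 <= \sum_i a i ^+ 2.
Proof. by apply: sumr_ge0 => i _; exact: sqr_ge0. Qed.

Lemma sqr_enorm n (x : 'cV_n) : enorm x ^+ 2 = \sum_i x i 0 ^+ 2.
Proof. by rewrite sqr_sqrtr ?sum_sqr_ge0. Qed.

Lemma sqr_enormE n (x : 'cV_n) : enorm x ^+ 2 = (x^T *m x) 0 0.
Proof.
by rewrite sqr_enorm mxE; apply: eq_bigr => i _; rewrite mxE expr2.
Qed.

Lemma enorm_eq0 n (x : 'cV_n) : (enorm x == 0) = (x == 0).
Proof.
rewrite -sqrf_eq0 sqr_enorm psumr_eq0; last by move=> i _; exact: sqr_ge0.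
apply/allP/eqP => [x0|-> i _]; last by rewrite /= mxE expr0n eqxx.
apply/colP => i; rewrite mxE; apply/eqP; rewrite -sqrf_eq0.
by apply: x0; rewrite mem_index_enum.
Qed.

Lemma enormN n (x : 'cV_n) : enorm (- x) = enorm x.
Proof. by rewrite /enorm; under eq_bigr => i _ do rewrite mxE sqrrN. Qed.

Lemma cauchy_schwarz n (a b : 'I_n -> R) :
  (\sum_i a i * b i) ^+ 2 <= (\sum_i a i ^+ 2) * (\sum_i b i ^+ 2).
Proof.
set c := \sum_i _ * _; set A := \sum_i _ ^+ 2; set B := \sum_i _ ^+ 2.
(* The squared length of B a - c b is B (A B - c^2). *)
have key : 0 <= B * (A * B - c ^+ 2).
  have : 0 <= \sum_i (B * a i - c * b i) ^+ 2 by exact: sum_sqr_ge0.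
  rewrite (eq_bigr (fun i => B ^+ 2 * a i ^+ 2 - 2 * B * c * (a i * b i)
    + c ^+ 2 * b i ^+ 2)) => [|i _]; last by ring.
  rewrite big_split sumrB /= -!mulr_sumr -/A -/B -/c.
  by congr (0 <= _); ring.
have [B0|Bgt0] := eqVneq B 0; last first.
  by rewrite pmulr_rge0 ?subr_ge0 // in key; rewrite lt0r Bgt0 sum_sqr_ge0.
rewrite /c big1 ?expr0n ?mulr_ge0 ?sum_sqr_ge0 // => i _.
have /eqP : b i ^+ 2 = 0.
  apply/eqP; rewrite eq_le sqr_ge0 andbT -B0 /B (bigD1 i) //= lerDl.
  by apply: sumr_ge0 => j _; exact: sqr_ge0.
by rewrite sqrf_eq0 => /eqP ->; rewrite mulr0.
Qed.

Lemma enormD n (x y : 'cV_n) : enorm (x + y) <= enorm x + enorm y.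
Proof.
rewrite -ler_sqr ?nnegrE ?addr_ge0 ?enorm_ge0 // sqrrD !sqr_enorm.
under eq_bigr => i _ do rewrite mxE sqrrD.
rewrite 2!big_split /= lerD2r lerD2l sumrMnl lerMn2r /=.
have := cauchy_schwarz (fun i => x i 0) (fun i => y i 0).
rewrite -!sqr_enorm -exprMn => h.
rewrite (le_trans (ler_norm _)) // -ler_sqr ?nnegrE ?mulr_ge0 ?enorm_ge0 //.
by rewrite real_normK ?num_real.
Qed.

(** Cauchy-Schwarz on each row: the operator norm is at most the Frobenius
    norm. *)
Lemma enorm_mul_entries m n (M : 'M[R]_(m, n)) (a : R) (x : 'cV_n) :
  0 <= a -> (forall i j, `|M i j| <= a) ->
  enorm (M *m x) <= Num.sqrt (m%:R * n%:R) * a * enorm x.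
Proof.
move=> a0 Ma.
rewrite -ler_sqr ?nnegrE ?mulr_ge0 ?sqrtr_ge0 ?enorm_ge0 //.
rewrite sqr_enorm !exprMn (@sqr_sqrtr _ (m%:R * n%:R)) ?mulr_ge0 //.
have row_le i : (M *m x) i 0 ^+ 2 <= n%:R * a ^+ 2 * enorm x ^+ 2.
  rewrite mxE (le_trans (cauchy_schwarz _ _)) // -sqr_enorm.
  rewrite ler_wpM2r ?sqr_ge0 // mulr_natl -[n in leRHS]card_ord -sumr_const.
  by apply: ler_sum => j _; rewrite -[leLHS]real_normK ?num_real // lerXn2r ?nnegrE.
apply: le_trans (ler_sum _ (fun i _ => row_le i)) _.
by rewrite sumr_const card_ord -[leLHS]mulr_natl !mulrA.
Qed.

(** Apply [enorm_mul_entries] to [invmx M] and [M *m x]; a bound on the entries of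
    the inverse thus keeps the singular values of [M] away from zero. *)
Lemma enorm_mul_unitmx n (M : 'M[R]_n) (a : R) (x : 'cV_n) :
  M \in unitmx -> 0 <= a -> (forall i j, `|invmx M i j| <= a) ->
  enorm x <= n%:R * a * enorm (M *m x).
Proof.
move=> Mu a0 /(enorm_mul_entries (M *m x) a0).
by rewrite mulKmx // -expr2 sqrtr_sqr ger0_norm.
Qed.

Lemma enorm_isometry m n (J : 'M[R]_(m, n)) (x : 'cV_n) :
  J^T *m J = 1%:M -> enorm (J *m x) = enorm x.
Proof.
move=> JJ; apply/eqP; rewrite -(@eqrXn2 _ 2) ?enorm_ge0 // !sqr_enormE.
by rewrite trmx_mul mulmxA -(mulmxA x^T) JJ mulmx1.
Qed.

(** [K^T] is then an isometry and [K^T K] an orthogonal projection. *)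
Lemma enorm_coisometry m n (K : 'M[R]_(m, n)) (x : 'cV_n) :
  K *m K^T = 1%:M -> enorm (K *m x) <= enorm x.
Proof.
move=> KK; rewrite -ler_sqr ?nnegrE ?enorm_ge0 // -subr_ge0.
suff -> : enorm x ^+ 2 - enorm (K *m x) ^+ 2
    = enorm (x - K^T *m (K *m x)) ^+ 2 by exact: sqr_ge0.
rewrite !sqr_enormE [(x - _)^T]linearB /= !(trmx_mul, trmxK) !(mulmxBl, mulmxBr).
rewrite !mulmxA -(mulmxA (x^T *m K^T) K K^T) KK mulmx1.
by rewrite subrr subr0 !mxE.
Qed.

End EuclideanNorm.

(** * Orthogonal diagonalization of real symmetric matrices *)

Section Spectral.
Variable R : rcfType.

(** Over [R[i]] the matrix is Hermitian, hence diagonalizable with a real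
    spectrum, and being an eigenvalue is a statement on the characteristic
    polynomial, which descends to [R]. *)
Lemma symmetric_eigenvalue n (M : 'M[R]_n.+1) :
  M^T = M -> exists a, eigenvalue M a.
Proof.
move=> Msym; pose toC := real_complex R; pose MC := map_mx toC M.
have MCh : MC \is hermsymmx.
  apply: realsym_hermsym.
    by apply/is_hermitianmxP; rewrite expr0 scale1r map_mx_id // map_trmx Msym.
  by apply/mxOverP => i j; rewrite mxE complex_real.
have /mxOverP/(_ 0 0)/complex_realP[a sp_a] := hermitian_spectral_diag_real MCh.
have /orthomx_spectralP MCE := hermitian_normalmx MCh.
exists a; rewrite eigenvalue_root_char -(fmorph_root toC) map_char_poly.
rewrite -eigenvalue_root_char; apply/eigenvalueP.
have Pu := spectral_unit MC.
set P := spectralmx MC in MCE Pu; set D := spectral_diag MC in MCE sp_a.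
exists (row 0 P).
  rewrite -row_mul -/MC [in LHS]MCE !mulmxA mulmxV // mul1mx row_mul.
  by rewrite row_diag_mx -scalemxAl -rowE sp_a.
apply/eqP => P0; have : delta_mx 0 0 *m P = 0 :> 'rV_n.+1 by rewrite -rowE.
move=> /(canRL (mulmxK Pu)); rewrite mul0mx => /rowP/(_ 0)/eqP.
by rewrite !mxE oner_eq0.
Qed.

(** The Householder reflection exchanging [v] and the first basis vector is such
    a matrix. *)
Lemma unit_row_orthogonal n (v : 'rV[R]_n.+1) :
  v *m v^T = 1%:M ->
  exists H : 'M[R]_n.+1, H^T *m H = 1%:M /\ row 0 H = v.
Proof.
move=> vv; pose e : 'rV[R]_n.+1 := delta_mx 0 0; pose w := v - e.
have ee : e *m e^T = 1%:M.
  by rewrite trmx_delta mul_delta_mx; apply/matrixP => i j; rewrite !ord1 !mxE.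
have ve : v *m e^T = (v 0 0)%:M.
  by rewrite trmx_delta -colE; apply/matrixP => i j; rewrite !ord1 !mxE.
have ev : e *m v^T = (v 0 0)%:M by rewrite -[LHS]trmxK trmx_mul trmxK ve tr_scalar_mx.
have ww : w *m w^T = (2 - 2 * v 0 0)%:M.
  rewrite /w [(v - e)^T]linearB /= !(mulmxBl, mulmxBr) vv ee ve ev -!raddfB /=.
  by congr _%:M; ring.
have ew : e *m w^T = (v 0 0 - 1)%:M by rewrite [w^T]linearB /= mulmxBr ev ee -raddfB.
(* The reflection is along w, which degenerates when v is already e. *)
have [w0|wn0] := eqVneq w 0.
  exists 1%:M; split; first by rewrite trmx1 mulmx1.
  by rewrite rowE mulmx1 -/e; apply/eqP; rewrite eq_sym -subr_eq0 -/w w0.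
set s := 2 - 2 * v 0 0 in ww.
have sn0 : s != 0.
  apply: contra_neq wn0 => s0; apply/eqP; rewrite -trmx_eq0 -enorm_eq0 -sqrf_eq0.
  by rewrite sqr_enormE trmxK ww s0 mxE mul0rn.
pose W := w^T *m w.
have WW : W *m W = s *: W.
  by rewrite /W mulmxA -(mulmxA w^T) ww mul_mx_scalar scalemxAl.
have HT : (1%:M - (2 / s) *: W)^T = 1%:M - (2 / s) *: W.
  by rewrite linearB /= trmx1 linearZ /= trmx_mul trmxK.
exists (1%:M - (2 / s) *: W); split.
  rewrite HT mulmxBl mul1mx mulmxBr mulmx1 -scalemxAl -scalemxAr WW.
  apply/matrixP => i j; rewrite !mxE; by field.
rewrite rowE -/e mulmxBr mulmx1 -scalemxAr mulmxA ew mul_scalar_mx scalerA.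
have -> : 2 / s * (v 0 0 - 1) = -1 by rewrite /s in sn0 *; field.
by rewrite scaleN1r opprK addrC subrK.
Qed.

(** Deflation: a unit eigenvector, completed to an orthogonal matrix [H], splits
    off a block of size one, and symmetry clears both off-diagonal blocks. *)
Lemma spectral_symmetric n (M : 'M[R]_n) : M^T = M ->
  exists Q : 'M[R]_n, Q^T *m Q = 1%:M /\ is_diag_mx (Q^T *m M *m Q).
Proof.
elim: n M => [|n IHn] M Msym.
  exists 1%:M; split; first by rewrite trmx1 mulmx1.
  by apply/is_diag_mxP => -[].
have [a /eigenvalueP[u uM un0]] := symmetric_eigenvalue Msym.
pose c := enorm u^T; pose v := c^-1 *: u.
have cn0 : c != 0 by rewrite enorm_eq0 trmx_eq0.
have vv : v *m v^T = 1%:M.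
  rewrite linearZ /= -scalemxAl -scalemxAr scalerA.
  apply/matrixP => i j; rewrite !ord1 mxE -{1}(trmxK u) -sqr_enormE -/c !mxE.
  by rewrite -invfM -expr2 mulVf // expf_neq0.
have vM : v *m M = a *: v by rewrite -scalemxAl uM scalerA mulrC -scalerA.
have [H [HH Hv]] := unit_row_orthogonal vv.
have HH' : H *m H^T = 1%:M by apply: mulmx1C.
have [N NE] : {N : 'M[R]_(1 + n) | N = H *m M *m H^T} by exists (H *m M *m H^T).
have Nsym : N^T = N by rewrite NE !trmx_mul trmxK Msym mulmxA.
have Nrow : row 0 N = a *: delta_mx 0 0.
  rewrite NE !row_mul Hv vM -scalemxAl -Hv -row_mul HH'.
  by rewrite rowE mulmx1.
have Nblock : N = block_mx a%:M 0 0 (drsubmx N).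
  have ur0 : ursubmx N = 0.
    apply/matrixP => i j; rewrite ord1 !mxE.
    have /rowP/(_ (rshift 1 j)) := Nrow; rewrite !mxE.
    rewrite (_ : rshift 1 j == 0 = false) ?andbF ?mulr0 //.
    by move/(etrans _); apply; congr (N _ _); apply/val_inj.
  have dl0 : dlsubmx N = 0 by rewrite -Nsym -trmx_ursub ur0 trmx0.
  have ula : ulsubmx N = a%:M.
    apply/matrixP => i j; rewrite !ord1 !mxE eqxx mulr1n.
    have /rowP/(_ 0) := Nrow; rewrite !mxE eqxx mulr1 => <-.
    by congr (N _ _); apply/val_inj.
  by rewrite -[LHS]submxK ur0 dl0 ula.
have [Q' [Q'Q' Q'd]] : exists Q : 'M[R]_n, Q^T *m Q = 1%:M /\
    is_diag_mx (Q^T *m drsubmx N *m Q).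
  by apply: IHn; rewrite trmx_drsub Nsym.
pose Q1 : 'M[R]_(1 + n) := block_mx 1%:M 0 0 Q'.
have Q1T : Q1^T = block_mx 1%:M 0 0 Q'^T by rewrite tr_block_mx trmx1 !trmx0.
have Q1Q1 : Q1^T *m Q1 = 1%:M.
  rewrite Q1T mulmx_block !(mulmx0, mul0mx, mulmx1, addr0, add0r) Q'Q'.
  by rewrite -scalar_mx_block.
have Q1d : is_diag_mx (Q1^T *m N *m Q1).
  rewrite Nblock Q1T !mulmx_block.
  rewrite !(mulmx0, mul0mx, mulmx1, mul1mx, addr0, add0r).
  by rewrite is_diag_block_mx // !eqxx Q'd andbT /= scalar_mx_is_diag.
exists (H^T *m Q1); rewrite trmx_mul trmxK; split.
  by rewrite mulmxA -(mulmxA _ H) HH' mulmx1.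
by rewrite !mulmxA -2!(mulmxA Q1^T) -NE.
Qed.

Lemma char_poly_orthogonal n (Q M : 'M[R]_n) : Q^T *m Q = 1%:M ->
  char_poly (Q^T *m M *m Q) = char_poly M.
Proof.
move=> QQ; rewrite /char_poly.
have -> : char_poly_mx (Q^T *m M *m Q)
    = map_mx polyC Q^T *m char_poly_mx M *m map_mx polyC Q.
  rewrite /char_poly_mx mulmxBr mulmxBl !map_mxM; congr (_ - _).
  by rewrite mul_mx_scalar -scalemxAl -map_mxM QQ map_mx1 scalemx1.
rewrite !det_mulmx mulrAC -det_mulmx -map_mxM QQ.
by rewrite map_mx1 det1 mul1r.
Qed.

(** Permuting the columns of the eigenvector matrix sorts the diagonal, and a
    sorted list of the roots of the characteristic polynomial can only be
    [eigenvalues M]. *)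
Lemma spectral_sorted n (M : 'M[R]_n) : M^T = M ->
  [/\ size (eigenvalues M) = n, sorted >=%R (eigenvalues M) &
    exists Q : 'M[R]_n, Q^T *m Q = 1%:M /\
      Q^T *m M *m Q = diag_mx (\row_i (eigenvalues M)`_i)].
Proof.
move=> /spectral_symmetric[Q [QQ /is_diag_mxP Qd]].
have [D DE] : {D | D = Q^T *m M *m Q} by exists (Q^T *m M *m Q).
rewrite -DE in Qd.
pose d := [tuple D i i | i < n]; pose s := sort >=%R d.
have size_s : size s = n by rewrite size_sort size_tuple.
have s_sorted : sorted >=%R s by apply: sort_sorted => x y; exact: le_total.
have /tuple_permP[p sE] : perm_eq s d by rewrite perm_sort.
have eigE : eigenvalues M = s.
  apply: eigenvaluesE => //; rewrite -(char_poly_orthogonal M QQ) -DE.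
  rewrite char_poly_trig; last by apply/is_diag_mx_is_trig/is_diag_mxP.
  by rewrite (perm_big d) ?perm_sort //= big_map big_enum.
rewrite eigE; split=> //; exists (col_perm p Q).
have colsE (A : 'M[R]_n) : (col_perm p Q)^T *m A *m col_perm p Q
    = mxsub p p (Q^T *m A *m Q).
  rewrite mxsub_mul -mul_rowsub_mx; congr (_ *m _ *m _);
    by apply/matrixP => i j; rewrite !mxE.
split.
  rewrite -[(col_perm p Q)^T]mulmx1 colsE mulmx1 QQ.
  by apply/matrixP => i j; rewrite !mxE (inj_eq perm_inj).
rewrite colsE -DE; apply/matrixP => i j; rewrite !mxE.
have -> : s`_i = D (p i) (p i).
  by rewrite sE -tnth_nth !tnth_mktuple.
have [->|ij] := eqVneq i j; first by rewrite mulr1n.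
by rewrite Qd // (inj_eq val_inj) (inj_eq perm_inj).
Qed.

End Spectral.

(** * Variational properties of singular values *)

Section SingularValues.
Variable R : rcfType.

Lemma gram_sym m n (A : 'M[R]_(m, n)) : (A^T *m A)^T = A^T *m A.
Proof. by rewrite trmx_mul trmxK. Qed.

Lemma gram_eigenvalues_le m n (A : 'M[R]_(m, n)) (i j : nat) :
  (i <= j < n)%N ->
  (eigenvalues (A^T *m A))`_j <= (eigenvalues (A^T *m A))`_i.
Proof.
move=> /andP[ij jn]; have [size_e sorted_e _] := spectral_sorted (gram_sym A).
have ge_tr : transitive (>=%R : rel R) by move=> y x z xy /le_trans; apply.
have ge_refl : reflexive (>=%R : rel R) by move=> x; exact: lexx.
apply: (sorted_leq_nth ge_tr ge_refl 0 sorted_e) => //; rewrite inE size_e //.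
exact: leq_ltn_trans jn.
Qed.

Lemma singular_value_le m n (A : 'M[R]_(m, n)) (i j : nat) :
  (i <= j <= n)%N -> (0 < j)%N -> singular_value A j <= singular_value A i.
Proof.
move=> /andP[ij jn] j0; apply: ler_wsqrtr; apply: gram_eigenvalues_le.
by rewrite -subn1 -[j.-1]subn1 leq_sub2r //= subn1 prednK.
Qed.

(** The columns of [J] are orthonormal eigenvectors of [A^T *m A], picked by [g];
    in these coordinates the quadratic form of [A^T *m A] is diagonal. *)
Lemma eigenframe m n p (A : 'M[R]_(m, n)) (g : 'I_p -> 'I_n) :
  injective g ->
  exists J : 'M[R]_(n, p), J^T *m J = 1%:M /\
    forall x : 'cV_p, enorm (A *m J *m x) ^+ 2
      = \sum_i (eigenvalues (A^T *m A))`_(g i) * x i 0 ^+ 2.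
Proof.
move=> g_inj; have [_ _ [Q [QQ QD]]] := spectral_sorted (gram_sym A).
set e := eigenvalues _ in QD *.
have colsE (M : 'M[R]_n) :
    (colsub g Q)^T *m M *m colsub g Q = mxsub g g (Q^T *m M *m Q).
  rewrite mxsub_mul -mul_rowsub_mx; congr (_ *m _ *m _).
  by apply/matrixP => i j; rewrite !mxE.
exists (colsub g Q); split.
  rewrite -[(colsub g Q)^T]mulmx1 colsE mulmx1 QQ.
  by apply/matrixP => i j; rewrite !mxE (inj_eq g_inj).
move=> x; rewrite sqr_enormE !trmx_mul !mulmxA.
rewrite -(mulmxA _ A^T A) -2!(mulmxA x^T) colsE QD.
rewrite mxE; apply: eq_bigr => j _; rewrite mxE (bigD1 j) //= big1.
  by rewrite addr0 !mxE eqxx mulr1n mulrAC mulrC expr2.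
by move=> i /negbTE ij; rewrite !mxE (inj_eq g_inj) ij mulr0.
Qed.

(** [J] consists of the leading [j] right singular vectors, on which the
    eigenvalues of [A^T *m A] are at least the [j]-th one. *)
Lemma top_singular_frame m n (A : 'M[R]_(m, n)) (j : nat) :
  (0 < j <= n)%N ->
  exists J : 'M[R]_(n, j), J^T *m J = 1%:M /\
    forall x, singular_value A j * enorm x <= enorm (A *m J *m x).
Proof.
move=> /andP[j0 jn]; have g_inj : injective (widen_ord jn).
  by move=> x y /(congr1 val) /= /val_inj.
have [J [JJ JE]] := eigenframe A g_inj; exists J; split=> // x.
rewrite -[enorm (_ *m _)]ger0_norm ?enorm_ge0 // -sqrtr_sqr JE.
rewrite /singular_value mulrC -[enorm x]ger0_norm ?enorm_ge0 // -sqrtr_sqr.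
rewrite -sqrtrM ?sqr_ge0 // mulrC sqr_enorm mulr_sumr ler_wsqrtr //.
apply: ler_sum => i _; rewrite ler_wpM2r ?sqr_ge0 // gram_eigenvalues_le //=.
by apply/andP; split; rewrite -ltnS prednK // ltn_ord.
Qed.

(** [J] consists of the right singular vectors from the [j]-th on, so that its
    range and that of [top_singular_frame] have the [j]-th one in common. *)
Lemma bottom_singular_frame m n (A : 'M[R]_(m, n)) (j : nat) :
  (0 < j <= n)%N ->
  exists J : 'M[R]_(n, n - j.-1), J^T *m J = 1%:M /\
    forall x, enorm (A *m J *m x) <= singular_value A j * enorm x.
Proof.
move=> /andP[j0 jn].
have jn' : (j.-1 + (n - j.-1))%N = n.
  by rewrite subnKC // (leq_trans (leq_pred j)).
pose g (i : 'I_(n - j.-1)) := cast_ord jn' (rshift j.-1 i).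
have g_inj : injective g by move=> x y /cast_ord_inj /rshift_inj.
have [J [JJ JE]] := eigenframe A g_inj; exists J; split=> // x.
rewrite -[enorm (_ *m _)]ger0_norm ?enorm_ge0 // -sqrtr_sqr JE.
rewrite /singular_value mulrC -[enorm x]ger0_norm ?enorm_ge0 // -sqrtr_sqr.
rewrite -sqrtrM ?sqr_ge0 // mulrC sqr_enorm mulr_sumr ler_wsqrtr //.
apply: ler_sum => i _; rewrite ler_wpM2r ?sqr_ge0 // gram_eigenvalues_le //.
by rewrite (ltn_ord (g i)) andbT leq_addr.
Qed.

(** The half of the Courant-Fischer theorem that bounds singular values from
    below.  The range of [J] has dimension [j] and the span of the trailing
    right singular vectors has dimension [n - j + 1], so they share a nonzero
    vector; there [A] stretches by at least [c] and by at most sigma_j. *)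
Lemma singular_value_ge m n j (A : 'M[R]_(m, n)) (J : 'M[R]_(n, j)) (c : R) :
  (0 < j)%N -> J^T *m J = 1%:M ->
  (forall x, c * enorm x <= enorm (A *m J *m x)) -> c <= singular_value A j.
Proof.
move=> j0 JJ Jc; have jn : (j <= n)%N := mulmx1_min JJ.
have [J' [J'J' J'c]] := bottom_singular_frame A (introT andP (conj j0 jn)).
have : kermx (row_mx J J')^T != 0.
  rewrite kermx_eq0 /row_free neq_ltn (leq_ltn_trans (rank_leq_col _)) //.
  by case: (j) j0 jn => // i _ ij; rewrite addSn ltnS subnKC // ltnW.
case/rowV0Pn => z /sub_kermxP zJ z0.
pose x := lsubmx z; pose y := rsubmx z.
have Jxy : J *m x^T = - (J' *m y^T).
  apply/eqP; rewrite -addr_eq0 -mul_row_col -tr_row_mx hsubmxK.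
  by rewrite -[_ *m _]trmxK trmx_mul trmxK zJ trmx0.
have xy : enorm x^T = enorm y^T.
  by rewrite -(enorm_isometry x^T JJ) Jxy enormN enorm_isometry.
have x_gt0 : 0 < enorm x^T.
  rewrite lt0r enorm_ge0 andbT; apply: contraNneq z0 => x0.
  rewrite -[z]hsubmxK -/x -/y -[x]trmxK -[y]trmxK.
  have /eqP -> : x^T == 0 by rewrite -enorm_eq0 x0.
  have /eqP -> : y^T == 0 by rewrite -enorm_eq0 -xy x0.
  by rewrite !trmx0 row_mx0.
rewrite -(ler_pM2r x_gt0) (le_trans (Jc _)) // xy.
by rewrite -mulmxA Jxy mulmxN enormN mulmxA J'c.
Qed.

(** Weyl's inequality: on the span of the leading [j] right singular vectors of
    [A + E], the matrix [A] loses at most [e] of the stretching. *)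
Lemma singular_valueD m n (A E : 'M[R]_(m, n)) (e : R) (j : nat) :
  (0 < j <= n)%N -> (forall x, enorm (E *m x) <= e * enorm x) ->
  singular_value (A + E) j <= singular_value A j + e.
Proof.
move=> jn Ee; have [J [JJ Jc]] := top_singular_frame (A + E) jn.
rewrite -lerBlDr; apply: (singular_value_ge _ JJ); first by case/andP: jn.
move=> x; rewrite mulrBl lerBlDr (le_trans (Jc x)) //.
rewrite !mulmxDl (le_trans (enormD _ _)) // lerD2l -mulmxA.
by rewrite -(enorm_isometry x JJ).
Qed.

(** [K] is a contraction, so the stretching by [K *m A *m J] is already achieved
    by [A] on the range of [J].  Submatrices are the case where [K] and [J]
    select rows and columns. *)
Lemma singular_value_ge_compression m n j (A : 'M[R]_(m, n))
    (K : 'M[R]_(j, m)) (J : 'M[R]_(n, j)) (c : R) :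
  (0 < j)%N -> K *m K^T = 1%:M -> J^T *m J = 1%:M ->
  (forall x, c * enorm x <= enorm (K *m A *m J *m x)) ->
  c <= singular_value A j.
Proof.
move=> j0 KK JJ KJc; apply: (singular_value_ge j0 JJ) => x.
by rewrite (le_trans (KJc x)) // -!mulmxA enorm_coisometry.
Qed.

(** The Gram matrix of [P *m A *m Q^T] is an orthogonal conjugate of that of
    [A]. *)
Lemma singular_value_orthogonal m n (A : 'M[R]_(m, n)) (P : 'M[R]_m)
    (Q : 'M[R]_n) (j : nat) :
  P^T *m P = 1%:M -> Q *m Q^T = 1%:M ->
  singular_value (P *m A *m Q^T) j = singular_value A j.
Proof.
move=> PP QQ; rewrite /singular_value /eigenvalues.
suff -> : char_poly ((P *m A *m Q^T)^T *m (P *m A *m Q^T))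
    = char_poly (A^T *m A) by [].
rewrite -(@char_poly_orthogonal _ _ Q^T (A^T *m A)) ?trmxK //.
congr char_poly; rewrite !trmx_mul !trmxK !mulmxA; congr (_ *m _ *m _).
by rewrite -(mulmxA _ P^T) PP mulmx1.
Qed.

Lemma singular_value_perm m n (A : 'M[R]_(m, n)) (p : 'S_m) (q : 'S_n)
    (j : nat) :
  singular_value (perm_mx p *m A *m (perm_mx q)^T) j = singular_value A j.
Proof.
by apply: singular_value_orthogonal;
  rewrite tr_perm_mx -perm_mxM ?mulVg ?mulgV perm_mx1.
Qed.

Lemma singular_value_castmx m n m' n' (em : m = m') (en : n = n')
    (A : 'M[R]_(m, n)) (j : nat) :
  singular_value (castmx (em, en) A) j = singular_value A j.
Proof. by case: m' / em; case: n' / en; rewrite castmx_id. Qed.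

End SingularValues.

(** * The pivot and the singular values of a truncated LU factorization *)

Section TruncatedLU.
Variables (R : realType) (k r s : nat).
Variables (L11 : 'M[R]_k) (L21 : 'M[R]_(r, k)) (U11 : 'M[R]_k)
  (U12 : 'M[R]_(k, s)) (S : 'M[R]_(r, s)) (p : 'I_r) (q : 'I_s).
Hypotheses (L11u : L11 \in unitmx) (U11u : U11 \in unitmx) (Spq : S p q != 0).

Let M : 'M[R]_(k + r, k + s) :=
  block_mx L11 0 L21 1%:M *m block_mx U11 U12 0 S.
Let B : 'M[R]_(k + r, k + s) := col_mx L11 L21 *m row_mx U11 U12.
Let Abar := bordered L11 L21 U11 U12 S p q.
Let X : 'M[R]_(k + 1) := invmx Abar.

Lemma truncation_error : M = B + block_mx 0 0 0 S.
Proof.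
rewrite /M /B mul_col_row mulmx_block add_block_mx.
by rewrite !(mulmx0, mul0mx, mul1mx, addr0, add0r).
Qed.

Lemma bordered_unit : Abar \in unitmx.
Proof.
rewrite /Abar /bordered unitmx_mul !unitmxE det_lblock det_ublock det1 mulr1.
by rewrite det_scalar1 unitrM -!unitmxE L11u U11u unitfE.
Qed.

(** The outer factors select the first [k] rows and columns together with those
    of the pivot: the bordered matrix is a submatrix of [M]. *)
Lemma bordered_compression :
  Abar = block_mx 1%:M 0 0 (delta_mx 0 p) *m M *m block_mx 1%:M 0 0 (delta_mx q 0).
Proof.
rewrite /Abar /bordered /M !mulmx_block.
rewrite !(mulmx0, mul0mx, mul1mx, mulmx1, addr0, add0r).
rewrite !(rowE, colE) !mulmxDr !mulmxDl !mulmxA; congr block_mx; congr (_ + _).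
rewrite -rowE -colE; apply/matrixP => i j.
by rewrite !ord1 !mxE eqxx mulr1n.
Qed.

(** The last row [z] of the inverse of the lower triangular factor satisfies
    [z *m Abar = row_mx 0 alpha], so the last row of [X] is [z] divided by alpha,
    and [z] ends with 1. *)
Lemma inv_bordered_corner : drsubmx X = (S p q)^-1%:M.
Proof.
pose z : 'M[R]_(1, k + 1) := row_mx (- (row p L21 *m invmx L11)) 1%:M.
have zA : z *m Abar = row_mx 0 (S p q)%:M.
  rewrite /Abar /bordered mulmxA /z mul_row_block !mul1mx mulmx0 add0r.
  rewrite mulNmx mulmxKV // addNr mul_row_block !mul0mx !mul1mx.
  by rewrite !add0r.
have : row_mx 0 (S p q)%:M *m X = z by rewrite -zA mulmxK ?bordered_unit.
rewrite -[X]submxK mul_row_block !mul0mx !add0r => /eq_row_mx[_].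
rewrite block_mxKdr mul_scalar_mx => /(congr1 (fun Y => (S p q)^-1 *: Y)).
by rewrite scalerA mulVf // scale1r scalemx1.
Qed.

(** The pivot block is a block of the inverse of [X], so its own inverse is the
    Schur complement in [X] of the corner, which is the inverse of the pivot. *)
Lemma inv_pivot_block :
  invmx (L11 *m U11) = ulsubmx X - S p q *: (ursubmx X *m dlsubmx X).
Proof.
have : Abar *m X = 1%:M by rewrite mulmxV ?bordered_unit.
rewrite -{1}[X]submxK inv_bordered_corner /Abar /bordered !mulmx_block.
rewrite !(mulmx0, mul0mx, mul1mx, mulmx1, addr0, add0r) scalar_mx_block.
case/eq_block_mx => Xul Xur _ _.
have LUu : L11 *m U11 \in unitmx by rewrite unitmx_mul L11u.
rewrite -[RHS](mulKmx LUu) -[LHS]mulmx1; congr (_ *m _).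
rewrite mulmxBr -scalemxAr mulmxA.
move: Xur; rewrite mul_mx_scalar => /(canRL (addrK _)); rewrite sub0r => ->.
rewrite mulNmx -scalemxAl scalerN scalerA divff // scale1r opprK.
by rewrite Xul.
Qed.

Lemma entry_le_mx_norm m n (Y : 'M[R]_(m, n)) i j : `|Y i j| <= mx_norm Y.
Proof. by rewrite mx_normrE (le_bigmax _ (fun ij => `|Y ij.1 ij.2|) (i, j)). Qed.

Variable f : R.
Hypotheses (f1 : 1 < f) (Smax : forall i j, `|S i j| <= `|S p q|).
Hypothesis (stop : mx_norm X <= f / `|S p q|).

Let a : R := `|S p q|.

Lemma pivot_gt0 : 0 < a. Proof. by rewrite normr_gt0. Qed.

Lemma inv_bordered_entry i j : `|X i j| <= f / a.
Proof. exact: le_trans (entry_le_mx_norm X i j) stop. Qed.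

(** The Schur complement has a term of size at most f / |alpha| and one of size
    at most |alpha| (f / |alpha|)^2; since f > 1 the second dominates. *)
Lemma inv_pivot_block_entry i j :
  `|invmx (L11 *m U11) i j| <= 2 * f ^+ 2 / a.
Proof.
have a0 := pivot_gt0; have f0 := lt_trans ltr01 f1.
have -> : invmx (L11 *m U11) i j = X (lshift 1 i) (lshift 1 j)
    - S p q * (X (lshift 1 i) (rshift k 0) * X (rshift k 0) (lshift 1 j)).
  by rewrite inv_pivot_block !mxE big_ord1 !mxE.
rewrite (le_trans (ler_normB _ _)) // !normrM -/a.
have h1 := inv_bordered_entry (lshift 1 i) (lshift 1 j).
have h2 := ler_wpM2l (ltW a0) (ler_pM (normr_ge0 _) (normr_ge0 _)
  (inv_bordered_entry (lshift 1 i) (rshift k 0))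
  (inv_bordered_entry (rshift k 0) (lshift 1 j))).
apply: le_trans (lerD h1 h2) _.
have -> : a * (f / a * (f / a)) = f ^+ 2 / a by field; rewrite gt_eqF.
rewrite -mulrA mulr_natl mulr2n lerD2r ler_pM2r ?invr_gt0 //.
by rewrite expr2 ler_peMr ?ltW.
Qed.

Lemma error_bound (x : 'cV[R]_(k + s)) :
  enorm (block_mx (0 : 'M_k) 0 0 S *m x)
    <= Num.sqrt ((k + r)%:R * (k + s)%:R) * a * enorm x.
Proof.
apply: enorm_mul_entries => [|i j]; first exact: ltW pivot_gt0.
have a0 := ltW pivot_gt0.
rewrite mxE; case: splitP => i' _; rewrite mxE; case: splitP => j' _;
  by rewrite ?mxE ?normr0.
Qed.

Lemma mul_delta_row_col n (i : 'I_n) :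
  (delta_mx 0 i : 'rV[R]_n) *m delta_mx i 0 = 1%:M.
Proof. by rewrite mul_delta_mx; apply/matrixP => x y; rewrite !ord1 !mxE. Qed.

(** The bordered matrix has order [k.+1] and an inverse with small entries, so it
    bounds sigma_(k+1) from below. *)
Lemma pivot_le_next_singular_value :
  a <= k.+1%:R * f * singular_value M k.+1.
Proof.
have a0 := pivot_gt0; have f0 := lt_trans ltr01 f1.
rewrite -ler_pdivrMl ?mulr_gt0 // -addn1.
apply: (singular_value_ge_compression (K := block_mx 1%:M 0 0 (delta_mx 0 p))
  (J := block_mx 1%:M 0 0 (delta_mx q 0))); rewrite ?addn1 //.
- rewrite tr_block_mx !trmx0 trmx1 trmx_delta mulmx_block.
  rewrite !(mulmx0, mul0mx, mul1mx, addr0, add0r) mul_delta_row_col.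
  by rewrite -scalar_mx_block.
- rewrite tr_block_mx !trmx0 trmx1 trmx_delta mulmx_block.
  rewrite !(mulmx0, mul0mx, mul1mx, addr0, add0r) mul_delta_row_col.
  by rewrite -scalar_mx_block.
move=> x; rewrite -bordered_compression.
have fa0 : 0 <= f / a by rewrite divr_ge0 ?ltW.
have := enorm_mul_unitmx x bordered_unit fa0 inv_bordered_entry.
move/(ler_wpM2l (ltW a0)) => le_ax.
have k1 : 0 < (k + 1)%:R :> R by rewrite ltr0n addn1.
rewrite -mulrA ler_pdivrMl ?mulr_gt0 // (le_trans le_ax) //.
by rewrite le_eqVlt; apply/orP; left; apply/eqP; field; rewrite gt_eqF.
Qed.

(** The pivot block [L11 *m U11] is the leading submatrix of [B]; it bounds
    sigma_k, hence every earlier singular value, from below. *)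
Lemma pivot_le_truncated_singular_value j : (0 < j <= k)%N ->
  a <= 2 * f ^+ 2 * k%:R * singular_value B j.
Proof.
case/andP=> j0 jk; have k0 : (0 < k)%N := leq_trans j0 jk.
have a0 := pivot_gt0; have f0 := lt_trans ltr01 f1.
have c0 : 0 < 2 * f ^+ 2 * k%:R by rewrite !mulr_gt0 ?exprn_gt0 ?ltr0n.
rewrite -ler_pdivrMl // mulrC.
have Bk : a / (2 * f ^+ 2 * k%:R) <= singular_value B k.
  apply: (singular_value_ge_compression (K := row_mx 1%:M 0)
    (J := col_mx 1%:M 0)) => //.
  - by rewrite tr_row_mx trmx1 trmx0 mul_row_col mulmx1 mulmx0 addr0.
  - by rewrite tr_col_mx trmx1 trmx0 mul_row_col mulmx1 mulmx0 addr0.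
  move=> x; rewrite /B !mulmxA mul_row_col mul1mx mul0mx addr0.
  rewrite -(mulmxA L11) mul_row_col mulmx1 mulmx0 addr0.
  have LUu : L11 *m U11 \in unitmx by rewrite unitmx_mul L11u.
  have fa0 : 0 <= 2 * f ^+ 2 / a.
    by rewrite divr_ge0 ?mulr_ge0 ?exprn_ge0 // ltW.
  have := enorm_mul_unitmx x LUu fa0 inv_pivot_block_entry.
  move/(ler_wpM2l (ltW a0)) => le_ax.
  rewrite mulrAC ler_pdivrMr // (le_trans le_ax) //.
  by rewrite le_eqVlt; apply/orP; left; apply/eqP; field; rewrite gt_eqF.
apply: le_trans Bk _; apply: singular_value_le => //.
by rewrite jk leq_addr.
Qed.

End TruncatedLU.

(** * From the additive to the multiplicative bounds *)

(** With [x] and [b] for the [j]-th singular values of the matrix and of its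
    truncation, and [t] for the next one, the additive error satisfies
    [w * a <= 2 w k f t] (from [k + 1 <= 2 k]) and the ratio of [x] to [b] is at
    most [1 + 2 f^2 k w <= 3 f^2 k w].  The upper bound uses the first estimate
    alone; the lower one amounts to [(x - b) x <= tau t b], and [tau] is the
    product of the two factors. *)
Lemma perturbation_arithmetic (R : realFieldType) (k w f a x b t tau : R) :
  1 <= k -> 1 <= w -> 1 < f -> 0 < a -> 0 < t -> t <= x ->
  a <= (k + 1) * f * t -> a <= 2 * f ^+ 2 * k * b ->
  x <= b + w * a -> b <= x + w * a ->
  tau = 6 * w ^+ 2 * k ^+ 2 * f ^+ 3 ->
  x / (1 + tau * (t / x)) <= b <= x * (1 + tau * (t / x)).
Proof.
move=> k1 w1 f1 a0 t0 tx at_ ab xb bx tauE.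
have [k0 w0 f0 x0] : [/\ 0 < k, 0 < w, 0 < f & 0 < x] by split; lra.
have wa : w * a <= 2 * w * k * f * t.
  have : w * a <= w * ((k + 1) * f * t) by rewrite ler_pM2l.
  have : 0 <= w * ((k - 1) * f * t).
    by rewrite !mulr_ge0 ?subr_ge0 // ltW.
  by lra.
have b0 : 0 < b.
  have c0 : 0 < 2 * f ^+ 2 * k by rewrite !mulr_gt0 ?exprn_gt0.
  by rewrite -(pmulr_rgt0 _ c0) (lt_le_trans a0).
have fk1 : 1 <= f ^+ 2 * k * w.
  by rewrite mulr_ege1 // mulr_ege1 // exprn_ege1 // ltW.
have x3 : x <= 3 * f ^+ 2 * k * w * b.
  have : w * a <= w * (2 * f ^+ 2 * k * b) by rewrite ler_pM2l.
  have : 0 <= (f ^+ 2 * k * w - 1) * b by rewrite mulr_ge0 ?subr_ge0 // ltW.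
  by lra.
have c0 : 0 <= 2 * w * k * f * t by rewrite !mulr_ge0 // ltW.
have tau0 : 0 < tau by rewrite tauE !mulr_gt0 ?exprn_gt0.
have cx : 2 * w * k * f * t * x <= tau * t * b.
  have -> : tau * t * b = 2 * w * k * f * t * (3 * f ^+ 2 * k * w * b).
    by rewrite tauE; ring.
  by rewrite ler_wpM2l.
have den : 1 + tau * (t / x) = (x + tau * t) / x by field; rewrite gt_eqF.
have tt0 : 0 < tau * t by rewrite mulr_gt0.
rewrite den; apply/andP; split.
  rewrite invf_div mulrA ler_pdivrMr ?addr_gt0 //.
  have : (x - b) * x <= 2 * w * k * f * t * x.
    by rewrite ler_wpM2r //; lra.
  by lra.
rewrite mulrC divfK ?gt_eqF //.
have ct : 2 * w * k * f * t <= tau * t.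
  rewrite ler_pM2r // tauE.
  have -> : 6 * w ^+ 2 * k ^+ 2 * f ^+ 3
    = 2 * w * k * f * (3 * (f ^+ 2 * k * w)) by ring.
  rewrite ler_peMr ?mulr_ge0 ?(ltW w0) ?(ltW k0) ?(ltW f0) //; lra.
by lra.
Qed.

Theorem theorem5 (R : realType) :
  exists C : R, 0 < C /\
  forall (m n k : nat) (hk1 : (1 <= k)%N) (hk : (k < minn m n)%N)
    (A : 'M[R]_(m, n)) (f : R) (hf : 1 < f)
    (p1 : 'S_m) (p2 : 'S_n)
    (L11 : 'M[R]_k) (L21 : 'M[R]_(m - k, k))
    (U11 : 'M[R]_k) (U12 : 'M[R]_(k, n - k))
    (S : 'M[R]_(m - k, n - k)),
  SRLU hk f A p1 p2 L11 L21 U11 U12 S ->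
  let Lhat : 'M[R]_(k + (m - k), k) := col_mx L11 L21 in
  let Uhat : 'M[R]_(k, k + (n - k)) := row_mx U11 U12 in
  exists tau : R,
    tau <= C * m%:R * n%:R * k%:R ^+ 2 * f ^+ 3 /\
    forall j : nat, (1 <= j <= k)%N ->
      singular_value A j
          / (1 + tau * (singular_value A k.+1 / singular_value A j))
        <= singular_value (Lhat *m Uhat) j
        <= singular_value A j
             * (1 + tau * (singular_value A k.+1 / singular_value A j)).
Proof.
exists 6; split=> // m n k hk1 hk A f hf p1 p2 L11 L21 U11 U12 S.
move=> [[[L11_trig L11_diag] U11_trig U11u PAQ] [p [q [Smax Spq stop]]]] Lhat Uhat.
have L11u : L11 \in unitmx.
  by rewrite unitmxE det_trig // big1 ?unitr1.
exists (6 * m%:R * n%:R * k%:R ^+ 2 * f ^+ 3); split=> // j /andP[j1 jk].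
set M := block_mx L11 0 L21 1%:M *m block_mx U11 U12 0 S in PAQ.
have svA i : singular_value A i = singular_value M i.
  by rewrite -(singular_value_castmx (subnKC_minl hk) (subnKC_minr hk)) -PAQ
    singular_value_perm.
have [mk nk] := (subnKC_minl hk, subnKC_minr hk).
have MB : M = Lhat *m Uhat + block_mx 0 0 0 S by exact: truncation_error.
have BM : Lhat *m Uhat = M + - block_mx 0 0 0 S by rewrite MB addrK.
have a0 : 0 < `|S p q| by rewrite normr_gt0.
have s0 : (0 < n - k)%N by apply: leq_ltn_trans (ltn_ord q).
have jn : (0 < j <= k + (n - k))%N by rewrite j1 (leq_trans jk) ?leq_addr.
pose w : R := Num.sqrt ((k + (m - k))%:R * (k + (n - k))%:R).
have w2 : w ^+ 2 = m%:R * n%:R.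
  by rewrite sqr_sqrtr ?mulr_ge0 // mk nk.
have -> : 6 * m%:R * n%:R * k%:R ^+ 2 * f ^+ 3 = 6 * w ^+ 2 * k%:R ^+ 2 * f ^+ 3.
  by rewrite w2 -!mulrA.
have next := pivot_le_next_singular_value L11u U11u Spq hf stop.
rewrite !svA; apply: (@perturbation_arithmetic _ k%:R w f `|S p q|) => //.
- by rewrite ler1n.
- rewrite -sqrtr1 ler_wsqrtr // -natrM ler1n muln_gt0.
  by rewrite !addn_gt0 hk1.
- have kf0 : 0 < k.+1%:R * f by rewrite mulr_gt0 ?ltr0n //; lra.
  by rewrite -(pmulr_rgt0 _ kf0) (lt_le_trans a0).
- apply: singular_value_le => //; rewrite (leq_trans jk) //=.
  by rewrite -addn1 leq_add2l.
- by rewrite natr1.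
- apply: pivot_le_truncated_singular_value stop _ _ => //; exact/andP.
- rewrite {1}MB; apply: singular_valueD => // x; exact: error_bound.
rewrite {1}BM; apply: singular_valueD => // x.
by rewrite mulNmx enormN; exact: error_bound.
Qed.
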